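(* Let $G=(V\cup\{m\},E)$ and $G'=(V'\cup\{m'\},E')$ be comparability graphs with disjoint vertex sets such that $\mathcal{R}^p(G)=k$ and $\mathcal{R}^p(G')=k'$, and let $H$ be the graph with vertex set $V\cup V'\cup\{m,m'\}$ and edge set $E\cup E'\cup\{\overline{mm'}\}$. If $H$ is a comparability graph, then $\mathcal{R}^p(H)=\max\{k,k'\}$ or $\mathcal{R}^p(H)=1+\max\{k,k'\}$.
   Context: All graphs are finite, simple and connected. A comparability graph is a graph admitting a transitive orientation ($\overrightarrow{ab},\overrightarrow{bc}$ imply $\overrightarrow{ac}$). A word over the vertex set represents a graph if distinct vertices are adjacent iff they alternate in the word (the subword formed by their occurrences is $abab\cdots$ or $baba\cdots$). Comparability graphs are exactly the graphs represented by a concatenation of permutations of their vertex set; the permutation-representation number $\mathcal{R}^p(G)$ of a comparability graph $G$ is the least number of permutations whose concatenation represents $G$. *)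

(* Defs.v *)
From mathcomp Require Import all_boot.

Set Implicit Arguments.
Unset Strict Implicit.
Unset Printing Implicit Defensive.

Record sgraph := SGraph {
  vertex :> finType;
  adj : rel vertex;
  adj_sym : symmetric adj;
  adj_irr : irreflexive adj }.

Definition connected_graph (G : sgraph) : Prop :=
  forall x y : G, connect (@adj G) x y.

Definition orientation (G : sgraph) (o : rel G) : Prop :=
  (forall x y : G, o x y -> adj x y) /\
  (forall x y : G, adj x y -> o x y (+) o y x).

Definition comparability_graph (G : sgraph) : Prop :=
  exists o : rel G, orientation o /\ transitive o.

(* altword a b n = a b a b ..., of length n. *)
Definition altword (T : Type) (a b : T) (n : nat) : seq T :=
  mkseq (fun i => if odd i then b else a) n.

Definition alternate (T : eqType) (x y : T) (w : seq T) : Prop :=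
  exists n : nat,
    filter (pred2 x y) w = altword x y n \/ filter (pred2 x y) w = altword y x n.

Definition represents (G : sgraph) (w : seq G) : Prop :=
  forall x y : G, x != y -> (adj x y <-> alternate x y w).

Definition vertex_permutation (G : sgraph) (p : seq G) : bool :=
  perm_eq p (enum G).

(* At least one permutation is required, so that every vertex occurs in the
   word; the empty word would vacuously represent every complete graph. *)
Definition perm_representable (G : sgraph) (k : nat) : Prop :=
  0 < k /\
  exists ps : seq (seq G),
    [/\ size ps = k, all (@vertex_permutation G) ps & represents (flatten ps)].

(* R^p(G) = k *)
Definition perm_rep_number (G : sgraph) (k : nat) : Prop :=
  perm_representable G k /\ forall j, perm_representable G j -> k <= j.

Section Bridge.
Variables (G G' : sgraph) (m : G) (m' : G').

Definition bridge_adj (u v : G + G') : bool :=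
  match u, v with
  | inl x, inl y => adj x y
  | inr x, inr y => adj x y
  | inl x, inr y => (x == m) && (y == m')
  | inr y, inl x => (x == m) && (y == m')
  end.

Lemma bridge_adj_sym : symmetric bridge_adj.
Proof. by move=> [x|x] [y|y] //=; apply: adj_sym. Qed.

Lemma bridge_adj_irr : irreflexive bridge_adj.
Proof. by move=> [x|x] /=; apply: adj_irr. Qed.

(* The disjoint union of G and G' together with the edge m m'. *)
Definition bridge_graph : sgraph := SGraph bridge_adj_sym bridge_adj_irr.

End Bridge.

(* Main.v *)
(* A concatenation of [n] permutations represents [G] iff adjacency is
   comparability in the intersection of the [n] linear orders.  Restricting the
   orders of [H] gives the lower bound [max k k'].

   For the upper bound pad both families to [n = max k k'] orders [p_i], [q_i].
   If [m] is the least element of its neighbourhood in the order realized by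
   the [p_i] and [m'] the greatest of its neighbourhood in that of the [q_i],
   then the [n + 1] orders [p_i q_i] and [(V' q_0) m m' (V p_0)] represent [H].

   A transitive orientation of [H] only says that some orientation of [G] has
   [m] as a source, whereas the orders [p_i] may realize another one, with
   [d < m < u].  Colour the edges by whether the two orientations agree on them:
   two edges of the triangle [d m u] have different colours, and a
   forcing argument yields a module containing [m] and excluding [d] or [u].
   By induction the module and the graph with the module contracted to [m] have
   realizers in which [m] is a source, and substituting one in the other gives a
   realizer of [G]. *)
From Stdlib Require Import Classical.
Require Import Defs.
From mathcomp Require Import all_boot.
From mathcomp Require Import zify.

Set Implicit Arguments.
Unset Strict Implicit.
Unset Printing Implicit Defensive.

(** * Linear orders as rank functions, and their intersection *)

Definition below (T : Type) (n : nat) (f : nat -> T -> nat) (x y : T) : bool :=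
  [forall i : 'I_n, f i x < f i y].

(** A linear order on [S] is encoded by ranks in [nat], injective on [S] but otherwise arbitrary, so
    that restricting, reversing and substituting orders become arithmetic on ranks. *)
Definition realizes (G : sgraph) (S : {set G}) (n : nat)
    (f : nat -> G -> nat) : Prop :=
  (forall i, i < n -> {in S &, injective (f i)}) /\
  {in S &, forall x y, x != y -> adj x y = below n f x y || below n f y x}.

Section Below.
Variables (T : Type) (n : nat).
Implicit Types (f : nat -> T -> nat) (x y z : T).

Lemma belowP f x y :
  reflect (forall i, i < n -> f i x < f i y) (below n f x y).
Proof.
apply: (iffP forallP) => [H i ltin|H i]; last exact: H.
exact: (H (Ordinal ltin)).
Qed.

Lemma below_trans f : transitive (below n f).
Proof.
move=> y x z /belowP xy /belowP yz; apply/belowP=> i ltin.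
exact: ltn_trans (xy i ltin) (yz i ltin).
Qed.

Lemma below_asym f x y : 0 < n -> below n f x y -> below n f y x = false.
Proof.
move=> n0 /belowP/(_ 0 n0) xy; apply/negP=> /belowP/(_ 0 n0).
by rewrite ltnNge ltnW.
Qed.

Lemma eq_below (T' : Type) f (g : nat -> T' -> nat) x y (x' y' : T') :
  (forall i, i < n -> (f i x < f i y) = (g i x' < g i y')) ->
  below n f x y = below n g x' y'.
Proof. by move=> fg; apply: eq_forallb => i; apply: fg. Qed.

End Below.

Lemma rank_bound (T : finType) (n : nat) (f : nat -> T -> nat) :
  exists N, forall i x, i < n -> f i x < N.
Proof.
exists (\max_(i < n) \max_(x : T) f i x).+1 => i x ltin.
rewrite ltnS (leq_trans (leq_bigmax x)) //.
exact: (leq_bigmax (F := fun i : 'I_n => \max_(x : T) f i x) (Ordinal ltin)).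
Qed.

(** * Alternation of two letters in a word cut into blocks *)

Section Words.

Lemma altwordS2 (T : Type) (x y : T) n :
  altword x y n.+2 = [:: x, y & altword x y n].
Proof.
rewrite /altword /mkseq /= -(addn2 0) addnC iotaDl -map_comp; congr [:: _, _ & _].
by apply: eq_map => i /=; rewrite negbK.
Qed.

(** Read two letters at a time, [altword x y n] repeats [x], [y], so a block [y], [x] would identify
    the two letters. *)
Lemma flatten_pairs_altword (T : eqType) (x y : T) (bs : seq bool) n :
  x != y ->
  flatten [seq if b then [:: x; y] else [:: y; x] | b <- bs] = altword x y n ->
  all id bs.
Proof.
move=> nxy; elim: bs n => //= b bs IH [|[|n]]; rewrite ?altwordS2; case: b => //=.
- by case=> /IH.
- by case=> exy; rewrite exy eqxx in nxy.
Qed.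

Lemma altword_flatten_pairs (T : eqType) (x y : T) (bs : seq bool) :
  all id bs ->
  flatten [seq if b then [:: x; y] else [:: y; x] | b <- bs] =
  altword x y (size bs).*2.
Proof.
elim: bs => //= b bs IH /andP[-> /IH E].
by rewrite doubleS altwordS2 /= E.
Qed.

Lemma filter_pred2_uniq (T : eqType) (x y : T) (p : seq T) :
  uniq p -> x \in p -> y \in p -> x != y ->
  filter (pred2 x y) p = if index x p < index y p then [:: x; y] else [:: y; x].
Proof.
elim: p => //= z p IH /andP[zp up]; rewrite !inE ![z == _]eq_sym.
have only u v : v \in p -> u \notin p -> filter (pred2 u v) p = [:: v].
  move=> vp up'; rewrite -(filter_pred1_uniq up vp).
  by apply: eq_in_filter => w wp /=; case: eqP => // E; rewrite E (negPf up') in wp.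
have C u v : filter (pred2 u v) p = filter (pred2 v u) p.
  by apply: eq_filter => w /=; rewrite orbC.
case: (x =P z) => [->|_] /=; case: (y =P z) => [->|_] //=; rewrite ?eqxx //=.
- by move=> _ yp nzy; rewrite only.
- by move=> xp _ nxz; rewrite C only.
by move=> xp yp nxy; rewrite IH.
Qed.

(** Each permutation contributes one block, [xy] or [yx], to the subword on [x] and [y]; two
    consecutive different blocks would repeat a letter, so alternation means that all blocks
    agree. *)
Lemma alternate_flatten (T : eqType) (x y : T) (ps : seq (seq T)) :
  x != y -> (forall p, p \in ps -> [/\ uniq p, x \in p & y \in p]) ->
  alternate x y (flatten ps) <->
  all (fun p => index x p < index y p) ps \/
  all (fun p => index y p < index x p) ps.
Proof.
move=> nxy psP.
have ltC p : p \in ps -> (index y p < index x p) = ~~ (index x p < index y p).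
  case/psP=> _ xp yp; rewrite -leqNgt ltn_neqAle andb_idl // => _.
  by apply: contraNneq nxy => E; rewrite -(nth_index x xp) -E nth_index.
rewrite (eq_in_all ltC) /alternate filter_flatten.
pose bs := [seq index x p < index y p | p <- ps].
have -> : [seq filter (pred2 x y) p | p <- ps] =
          [seq if b then [:: x; y] else [:: y; x] | b <- bs].
  rewrite -map_comp; apply/eq_in_map => p /psP[up xp yp] /=.
  exact: filter_pred2_uniq.
have negE : [seq if b then [:: x; y] else [:: y; x] | b <- bs] =
            [seq if b then [:: y; x] else [:: x; y] | b <- map negb bs].
  by rewrite -map_comp; apply: eq_map => b /=; case: b.
have -> : all (fun p => index x p < index y p) ps = all id bs by rewrite all_map.
have -> : all (fun p => ~~ (index x p < index y p)) ps = all id (map negb bs).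
  by rewrite !all_map.
split=> [[n [E|E]]|[E|E]].
- by left; apply: flatten_pairs_altword E.
- by right; rewrite negE in E; apply: flatten_pairs_altword E; rewrite eq_sym.
- by exists (size bs).*2; left; apply: altword_flatten_pairs.
- by exists (size (map negb bs)).*2; right; rewrite negE altword_flatten_pairs.
Qed.

End Words.

(** * Permutation words and realizers *)

Lemma index_sort_rank (T : finType) (r : T -> nat) (x y : T) :
  injective r ->
  (index x (sort (relpre r leq) (enum T)) < index y (sort (relpre r leq) (enum T)))
  = (r x < r y).
Proof.
move=> rI; set s := sort _ _.
have sT z : z \in s by rewrite mem_sort mem_enum.
have tr : transitive (relpre r leq) by move=> a b c; apply: leq_trans.
have ss : sorted (relpre r leq) s by apply: sort_sorted => a b; apply: leq_total.
have le a b : index a s <= index b s -> r a <= r b.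
  exact: (sorted_leq_index tr (fun a => leqnn (r a)) ss a b (sT a) (sT b)).
apply/idP/idP => [lt|]; last by apply: contraTT; rewrite -!leqNgt => /le.
rewrite ltn_neqAle le 1?ltnW // andbT; apply: contraTneq lt => /rI ->.
by rewrite ltnn.
Qed.

(** Positions in the permutations serve as ranks; conversely, sorting the vertices by each rank
    function gives the permutations. *)
Lemma perm_representableP (G : sgraph) (k : nat) :
  perm_representable G k <-> 0 < k /\ exists f, realizes [set: G] k f.
Proof.
split=> -[k0 [w]].
  case=> szw /allP permw rep; split=> //.
  exists (fun i x => index x (nth [::] w i)).
  have inw i : i < k -> nth [::] w i \in w by rewrite -szw; apply: mem_nth.
  have allin p x : p \in w -> x \in p.
    by move=> /permw /perm_mem ->; rewrite mem_enum.
  split=> [i /inw pw x y _ _ E|x y _ _ nxy].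
    by rewrite -(nth_index x (allin _ x pw)) E nth_index // allin.
  have alt := alternate_flatten nxy (ps := w).
  have allE (a b : G) : all (fun p => index a p < index b p) w =
      below k (fun i x => index x (nth [::] w i)) a b.
    apply/(all_nthP [::])/belowP; rewrite szw; exact.
  rewrite -!allE; apply/idP/orP => [/(rep _ _ nxy)|] H.
    apply/alt => // p pw; split; rewrite ?allin //.
    by rewrite (perm_uniq (permw _ pw)) enum_uniq.
  apply/(rep _ _ nxy)/alt => // p pw; split; rewrite ?allin //.
  by rewrite (perm_uniq (permw _ pw)) enum_uniq.
case=> inj real; split=> //.
pose p i := sort (relpre (w i) leq) (enum G).
exists (mkseq p k); split; first by rewrite size_mkseq.
  by apply/allP => _ /mapP[i _ ->]; rewrite /vertex_permutation perm_sort.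
move=> x y nxy; rewrite real ?inE //.
have allE (a b : G) : all (fun p => index a p < index b p) (mkseq p k) =
    below k w a b.
  apply/allP/belowP => [H i ltik|H _ /mapP[i + ->]]; last first.
    rewrite mem_iota => /andP[_ ltik]; rewrite index_sort_rank ?H //.
    by move=> u v; apply: inj; rewrite ?inE.
  have := H (p i); rewrite index_sort_rank; first by apply; rewrite map_f ?mem_iota.
  by move=> u v; apply: inj; rewrite ?inE.
rewrite -!allE; split=> [/orP|] H.
  apply/alternate_flatten => // _ /mapP[i _ ->].
  by rewrite sort_uniq enum_uniq !mem_sort !mem_enum.
apply/orP; apply/alternate_flatten => // _ /mapP[i _ ->].
by rewrite sort_uniq enum_uniq !mem_sort !mem_enum.
Qed.

(** * Operations on realizers, and modules *)

Section Modules.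
Variable G : sgraph.
Implicit Types (S M : {set G}) (f g : nat -> G -> nat) (m x y : G).

Lemma realizes_sub S M n f : M \subset S -> realizes S n f -> realizes M n f.
Proof.
move=> /subsetP sMS [inj real]; split=> [i ltin|] x y /sMS xS /sMS yS.
  exact: inj.
exact: real.
Qed.

Lemma below_adj S n f x y :
  0 < n -> realizes S n f -> x \in S -> y \in S -> below n f x y -> adj x y.
Proof.
move=> n0 [_ real] xS yS xy; rewrite real ?xy //.
by apply: contraTneq xy => ->; apply/negP => /belowP/(_ 0 n0); rewrite ltnn.
Qed.

Lemma realizes_rev S n f :
  realizes S n f ->
  exists f', realizes S n f' /\ forall x y, below n f' x y = below n f y x.
Proof.
move=> [inj real]; have [N fN] := rank_bound n f.
(* [N] exceeds every rank, so the truncated subtraction is strictly decreasing on the ranks. *)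
have E x y : below n (fun i x => N - f i x) x y = below n f y x.
  by apply: eq_below => i ltin; have := fN i x ltin; have := fN i y ltin; lia.
exists (fun i x => N - f i x); split=> //; split=> [i ltin x y xS yS|x y xS yS nxy].
  move=> e; apply: (inj i) => //.
  by have := fN i x ltin; have := fN i y ltin; lia.
by rewrite !E orbC real.
Qed.

Lemma realizes_pad S n n' f :
  0 < n <= n' -> realizes S n f -> exists f', realizes S n' f'.
Proof.
(* The last order, of index [n.-1], is repeated; this leaves the intersection of the orders
   unchanged. *)
case/andP=> n0 le [inj real]; exists (fun i => f (minn i n.-1)).
have E x y : below n' (fun i => f (minn i n.-1)) x y = below n f x y.
  apply/belowP/belowP => H i lti; last by apply: H; lia.
  by have := H i (leq_trans lti le); have -> : minn i n.-1 = i by lia.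
split=> [i lti|x y xS yS nxy]; first by apply: inj; lia.
by rewrite !E real.
Qed.

Lemma ltn_lex N a a' b b' : b < N -> b' < N -> a != a' ->
  (a * N + b < a' * N + b') = (a < a').
Proof. by move=> bN b'N ne; apply/idP/idP; nia. Qed.

Definition module S M : Prop :=
  M \subset S /\
  {in M &, forall a b, {in S :\: M, forall x, adj x a = adj x b}}.

(** The new orders are lexicographic: first by [f] with [M] collapsed to [m], then by [g] inside
    [M]. They realize [S] because [m] has the same neighbours outside [M] as every member of [M]. *)
Lemma substitute_module S M m n f g :
  module S M -> m \in M ->
  realizes (m |: (S :\: M)) n f -> realizes M n g ->
  exists h, [/\ realizes S n h, {in M &, below n h =2 below n g} &
    {in S & S :\: M, forall x y,
       below n h x y = below n f (if x \in M then m else x) y}].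
Proof.
move=> [/subsetP sMS modM] mM [injf realf] [injg realg].
have [N gN] := rank_bound n g.
pose rep x := if x \in M then m else x.
pose h i x := f i (rep x) * N + (if x \in M then g i x else 0).
have repS x : x \in S -> rep x \in m |: (S :\: M).
  by rewrite /rep !inE; case: ifP => [_|->]; rewrite ?eqxx //= => ->; rewrite orbT.
have h_in i x y : x \in M -> y \in M -> (h i x < h i y) = (g i x < g i y).
  by rewrite /h /rep => -> ->; rewrite ltn_add2l.
have h_out i x y : i < n -> x \in S -> y \in S -> rep x != rep y ->
    (h i x < h i y) = (f i (rep x) < f i (rep y)).
  move=> ltin xS yS ne; have N0 := gN i x ltin.
  rewrite ltn_lex //; try by case: ifP => // _; rewrite ?gN // (leq_ltn_trans _ N0).
  by apply: contra ne => /eqP/(injf i ltin); rewrite !repS // => ->.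
have rep_ne x y : x \notin M -> x != y -> rep x != rep y.
  rewrite /rep => /negPf xM; rewrite xM; case: ifP => // _ _.
  by apply: contraFneq xM => ->.
have rep_neC x y : (x \notin M) || (y \notin M) -> x != y -> rep x != rep y.
  case/orP=> [|yM]; first exact: rep_ne.
  by rewrite eq_sym => /(rep_ne _ _ yM); rewrite eq_sym.
have b_in : {in M &, below n h =2 below n g}.
  by move=> x y xM yM; apply: eq_below => i _; apply: h_in.
have b_out x y : x \in S -> y \in S -> rep x != rep y ->
    below n h x y = below n f (rep x) (rep y).
  by move=> xS yS ne; apply: eq_below => i ltin; apply: h_out.
have adj_rep x y : x \in S -> y \in S -> (x \notin M) || (y \notin M) ->
    adj x y = adj (rep x) (rep y).
  rewrite /rep; have [xM|xM] := boolP (x \in M); have [yM|yM] //= := boolP (y \in M).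
    move=> _ yS _; rewrite adj_sym [RHS]adj_sym.
    by apply: modM; rewrite // !inE yM.
  by move=> xS _ _; apply: modM; rewrite // !inE xM.
exists h; split=> //; last first.
  move=> x y xS /setDP[yS yM]; have [->|nxy] := eqVneq x y.
    by rewrite (negPf yM); apply: eq_below => i _; rewrite !ltnn.
  by rewrite b_out ?rep_neC ?yM ?orbT // /rep (negPf yM).
split=> [i ltin x y xS yS E|x y xS yS nxy].
  apply/eqP; apply/idP/idPn => nxy.
  (* Equal ranks mean that both strict comparisons fail, and [h_in] and [h_out] carry this back to
     [g] and [f]. *)
  have lt0 u v : h i u = h i v -> (h i u < h i v) = false by move=> ->; rewrite ltnn.
  have [xyM|] := boolP ((x \in M) && (y \in M)).
    case/andP: xyM => xM yM; case/eqP: nxy; apply: (injg i) => //.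
    have := lt0 _ _ E; have := lt0 _ _ (esym E); rewrite !h_in //; lia.
  rewrite negb_and => /rep_neC/(_ nxy) ne.
  case/eqP: (ne); apply: (injf i); rewrite ?repS //.
  have := lt0 _ _ E; have := lt0 _ _ (esym E).
  by rewrite !h_out // 1?eq_sym //; lia.
have [xyM|] := boolP ((x \in M) && (y \in M)).
  by case/andP: xyM => xM yM; rewrite !b_in // realg.
rewrite negb_and => xyM; have ne := rep_neC _ _ xyM nxy.
by rewrite adj_rep // !b_out // 1?eq_sym // realf ?repS.
Qed.

(* Gallai's triangle argument: [c] is a two-colouring of the edges that is
   constant on the classes of the forcing relation.  If the edge opposite to
   [d] in a triangle is the only one of its colour, its class does not reach
   [d], and the vertices that this class does reach form a module. *)
Lemma triangle_module S (c : rel G) d m u :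
  {in S &, forall x y, adj x y -> c x y = c y x} ->
  {in S & &, forall x a b, x != b -> adj x a -> adj a b -> ~~ adj x b ->
     c x a = c a b} ->
  d \in S -> m \in S -> u \in S ->
  adj d m -> adj d u -> adj m u ->
  c d m != c m u -> c d u != c m u ->
  exists M, [/\ module S M, m \in M, u \in M & d \notin M].
Proof.
move=> csym cforce dS mS uS dm du mu cdm cdu.
(* The component [M] of [m] is grown inside [T], along edges with the colour of [m u]; [d] is not in
   [T], being no neighbour of itself. *)
pose T := [set x in S | adj d x && (c d x != c m u)].
pose r x y := [&& x \in T, y \in T, adj x y & c x y == c m u].
have TS x : x \in T -> x \in S by rewrite inE => /andP[].
have rsym : symmetric r.
  move=> x y; rewrite /r [adj y x]adj_sym; have [xT|] := boolP (x \in T);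
    have [yT|] //= := boolP (y \in T).
  by apply: andb_id2l => xy; rewrite csym ?TS.
have mT : m \in T by rewrite inE mS dm.
pose M := [set x | connect r m x].
have MT x : x \in M -> x \in T.
  rewrite inE => /connectP[p + ->]; case/lastP: p => // p z.
  by rewrite rcons_path last_rcons => /andP[_ /and4P[]].
(* Suppose [x] is adjacent to [a] but not to [b]. Forcing gives [x a] the colour of [m u]. Then [d]
   is adjacent to [x], as otherwise [d a] would have that colour too; and [d x] has the colour of
   [d b], so [x] is in [T], hence in [M]. *)
have adj_step a b x : r a b -> a \in M -> b \in M -> x \in S :\: M ->
    adj x a -> adj x b.
  case/and4P=> aT bT ab /eqP cab aM bM /setDP[xS xM] xa.
  have nxb : x != b by apply: contraNneq xM => ->.
  apply: contraNT xM => xb.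
  have cxa : c x a = c m u.
    by rewrite -cab; apply: (cforce x a b) => //; rewrite TS.
  have [_ /andP[da cda]] := setIdP aT; have [_ /andP[db cdb]] := setIdP bT.
  have dx : adj d x.
    apply: contraNT cda => dx; rewrite -cxa; apply/eqP.
    rewrite (csym x a) // ?TS //; apply: (cforce d a x); rewrite // ?TS // 1?adj_sym //.
    by apply: contraNneq xb => <-.
  have cdx : c d x = c d b.
    rewrite csym // ?TS // 1?adj_sym //; apply: cforce; rewrite // ?TS //.
    by rewrite adj_sym.
  have xT : x \in T by rewrite inE xS dx cdx.
  have rax : r a x.
    by rewrite /r aT xT adj_sym xa csym // ?TS // 1?adj_sym // cxa eqxx.
  by move: aM; rewrite !inE => /connect_trans; apply; apply: connect1.
have adj_path x p a : x \in S :\: M -> a \in M -> path r a p ->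
    adj x (last a p) = adj x a.
  move=> xSM; elim: p a => //= z p IH a aM /andP[raz rp].
  have zM : z \in M.
    by move: aM; rewrite !inE => /connect_trans; apply; apply: connect1.
  rewrite IH //; apply/idP/idP; last exact: adj_step raz aM zM xSM.
  by apply: adj_step zM aM xSM; rewrite rsym.
have mM : m \in M by rewrite inE connect0.
have adj_m y x : y \in M -> x \in S :\: M -> adj x y = adj x m.
  by rewrite inE => /connectP[p rp ->] xSM; apply: adj_path.
exists M; split=> //.
- split; first by apply/subsetP => x /MT/TS.
  by move=> a b aM bM x xSM; rewrite !adj_m.
- rewrite inE; apply: connect1; rewrite /r mT mu eqxx !andbT.
  by rewrite inE uS du.
by apply/negP => /MT; rewrite inE adj_irr andbF.
Qed.

(** * Transitive orientations, and turning a vertex into a source *)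

Definition orients (S : {set G}) (o : rel G) : Prop :=
  {in S &, forall x y, o x y -> adj x y} /\
  {in S &, forall x y, adj x y -> o y x = ~~ o x y}.

(** If one of the two edges entered [a] and the other left it, transitivity would make [x] and [b]
    adjacent. *)
Lemma orients_forcing S (o : rel G) x a b :
  orients S o -> transitive o -> x \in S -> a \in S -> b \in S ->
  adj x a -> adj a b -> ~~ adj x b -> o x a = o b a.
Proof.
move=> [oadj oC] otr xS aS bS xa ab nadj.
have no u v w : u \in S -> w \in S -> o u v -> o v w -> adj u w.
  by move=> uS wS uv /(otr _ _ _ uv); apply: oadj.
apply/idP/idP=> H; apply: contraNT nadj; rewrite ?(oC a b) ?negbK //.
  exact: no H.
by rewrite -oC // adj_sym => /(no _ _ _ bS xS H); rewrite adj_sym.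
Qed.

Lemma orientation_orients S (o : rel G) : orientation o -> orients S o.
Proof.
move=> [oadj oor]; split=> [x y _ _|x y _ _ /oor]; first exact: oadj.
by case: (o x y); case: (o y x).
Qed.

Lemma realizes_orients S n f : 0 < n -> realizes S n f -> orients S (below n f).
Proof.
move=> n0 rf; split=> [x y xS yS|x y xS yS xy]; first exact: (below_adj n0 rf).
have := xy; rewrite (proj2 rf) //; last first.
  by apply: contraTneq xy => ->; rewrite adj_irr.
by have [xy'|nxy] /= := boolP (below n f x y); [rewrite below_asym|move=> ->].
Qed.

Lemma realizes_source S n f (q : rel G) m :
  0 < n -> realizes S n f -> orientation q -> transitive q -> m \in S ->
  {in S, forall x, adj m x -> q m x} ->
  exists f', realizes S n f' /\ {in S, forall x, adj m x -> below n f' m x}.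
Proof.
move=> n0 + oq tq; move: {2}#|S|.+1 (ltnSn #|S|) => N.
elim: N S f => // N IH S f; rewrite ltnS => leN rf mS qm.
have [padj pC] := realizes_orients n0 rf; have [qadj qC] := orientation_orients S oq.
have [/existsP[d /and3P[dS md ndm]]|] :=
  boolP [exists d, [&& d \in S, adj m d & ~~ below n f m d]]; last first.
  move=> /existsPn H; exists f; split=> // x xS mx.
  by have := H x; rewrite xS mx /= negbK.
(* Now some neighbour [d] lies below [m]. If none lies above, reversing all the orders makes [m] a
   source. *)
have [/existsP[u /and3P[uS mu pmu]]|] :=
  boolP [exists u, [&& u \in S, adj m u & below n f m u]]; last first.
  move=> /existsPn H; have [f' [rf' f'E]] := realizes_rev rf.
  exists f'; split=> // x xS mx; rewrite f'E pC //.
  by have := H x; rewrite xS mx.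
have dm : adj d m by rewrite adj_sym.
have pdm : below n f d m by rewrite pC.
have um : adj u m by rewrite adj_sym.
have du : adj d u by apply: padj => //; apply: below_trans pmu.
have ud : adj u d by rewrite adj_sym.
(* Reversing an edge negates both truth values, and forcing carries both along, so agreement is a
   colouring as required by [triangle_module]. *)
pose c x y := below n f x y == q x y.
have csym : {in S &, forall x y, adj x y -> c x y = c y x}.
  by move=> x y xS yS xy; rewrite /c (pC x y) // (qC x y) // (inj_eq negb_inj).
have cforce : {in S & &, forall x a b, x != b -> adj x a -> adj a b ->
    ~~ adj x b -> c x a = c a b}.
  move=> x a b xS aS bS _ xa ab nxb; rewrite [RHS]csym // /c.
  rewrite (orients_forcing (realizes_orients n0 rf) _ _ _ _ xa ab) //; last first.
    exact: below_trans.
  by rewrite (orients_forcing (orientation_orients S oq) tq _ _ _ xa ab).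
have cmu : c m u by rewrite /c pmu qm.
have cmd : c m d = false by rewrite /c (negPf ndm) qm.
have [M [modM mM zM wM]] : exists M, [/\ module S M, m \in M,
    exists2 z, z \in M & z != m & exists2 w, w \in S & w \notin M].
  (* As [m u] and [m d] differ in colour, the colour of [d u] decides which of them is the odd edge
     of the triangle; the vertex opposite to it is the one excluded from the module. *)
  have [cdu|cdu] := boolP (c d u).
    have [||M [? ? dM uM]] := triangle_module csym cforce uS mS dS um ud md.
    - by rewrite csym // cmu cmd.
    - by rewrite csym // cdu cmd.
    exists M; split=> //; last by exists u.
    by exists d => //; apply: contraTneq md => ->; rewrite adj_irr.
  have [||M [? ? uM dM]] := triangle_module csym cforce dS mS uS dm du mu.
  - by rewrite csym // cmd cmu.
  - by rewrite cmu (negPf cdu).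
  exists M; split=> //; last by exists d.
  by exists u => //; apply: contraTneq mu => ->; rewrite adj_irr.
have [/subsetP MS adjM] := modM.
(* The contraction of [M] is taken inside [G], with [m] representing [M]. Both [R] and [M] are
   smaller than [S]: [R] lacks a vertex of [M] other than [m], and [M] lacks a vertex of [S]. *)
pose R := m |: (S :\: M).
have RS : R \subset S by apply/subsetP => x /setU1P[->|/setDP[]].
have MSs : M \subset S by apply/subsetP.
have ltM : #|M| < #|S|.
  by have [w ? ?] := wM; apply: proper_card; apply/properP; split; last exists w.
have ltR : #|R| < #|S|.
  have [z zM' zm] := zM; apply: proper_card; apply/properP; split; first by [].
  by exists z; [exact: MS|rewrite !inE negb_or zm zM'].
have mR : m \in R by rewrite setU11.
have sub (A : {set G}) : A \subset S -> {in A, forall x, adj m x -> q m x}.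
  by move=> AS x xA; apply: (qm x (subsetP AS x xA)).
have [f1 [rf1 f1m]] := IH R f (leq_trans ltR leN) (realizes_sub RS rf) mR (sub _ RS).
have [g1 [rg1 g1m]] := IH M f (leq_trans ltM leN) (realizes_sub MSs rf) mM (sub _ MSs).
have [h [rh hM hR]] := substitute_module modM mM rf1 rg1.
exists h; split=> // x xS mx; have [xM|xM] := boolP (x \in M).
  by rewrite hM ?g1m.
have xSM : x \in S :\: M by rewrite inE xM.
by rewrite hR // mM f1m // !inE xM xS orbT.
Qed.

End Modules.

(** * Induced subgraphs and the bridge graph *)

Lemma perm_representable_embed (G H : sgraph) (h : G -> H) k :
  injective h -> (forall x y, adj (h x) (h y) = adj x y) ->
  perm_representable H k -> perm_representable G k.
Proof.
move=> hI hadj /perm_representableP[k0 [f [inj real]]].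
apply/perm_representableP; split=> //; exists (fun i x => f i (h x)).
split=> [i ltik x y _ _ /(inj i ltik)|x y _ _ nxy].
  by rewrite !inE => /(_ isT isT)/hI.
by rewrite -hadj real ?inE ?(inj_eq hI).
Qed.

Section Bridge.
Variables (G G' : sgraph) (m : G) (m' : G').

(** In the first [n] orders all of [V] with [m] precedes all of [V'] with [m'], so the extra order
    alone decides the crossing pairs, and there only [m] precedes [m']. *)
Lemma bridge_realizes n (f : nat -> G -> nat) (g : nat -> G' -> nat) :
  0 < n -> realizes [set: G] n f -> realizes [set: G'] n g ->
  (forall x, adj m x -> below n f m x) ->
  (forall y, adj m' y -> below n g y m') ->
  exists h, realizes [set: bridge_graph m m'] n.+1 h.
Proof.
move=> n0 rf rg mf mg.
have [injf realf] := rf; have [injg realg] := rg.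
have [N fN] := rank_bound n f; have [N' gN'] := rank_bound n g.
(* The extra order: [V'], then [m], then [m'], then [V]. *)
pose last (z : G + G') := match z with
  | inl x => if x == m then N' else N' + 2 + f 0 x
  | inr y => if y == m' then N' + 1 else g 0 y end.
pose h i (z : G + G') := if i == n then last z else
  match z with inl x => f i x | inr y => N + g i y end.
have hS z t : below n.+1 h z t = below n h z t && (last z < last t).
  apply/belowP/andP => [H|[/belowP H lt] i].
    split; last by have := H n (leqnn _); rewrite /h eqxx.
    by apply/belowP=> i ltin; apply: H; rewrite ltnS ltnW.
  rewrite ltnS leq_eqVlt => /predU1P[->|]; last exact: H.
  by rewrite /h eqxx.
have hl x y : below n h (inl x) (inl y) = below n f x y.
  by apply: eq_below => i ltin; rewrite /h ltn_eqF.
have hr x y : below n h (inr x) (inr y) = below n g x y.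
  by apply: eq_below => i ltin; rewrite /h ltn_eqF // ltn_add2l.
have hlr x y : below n h (inl x) (inr y).
  apply/belowP=> i ltin; rewrite /h ltn_eqF //.
  by rewrite (leq_trans (fN i x ltin)) // leq_addr.
have below_m x : below n f x m = false.
  apply: contraTF isT => xm.
  have /mf mx : adj m x by rewrite adj_sym (below_adj n0 rf) ?inE.
  by rewrite (below_asym n0 mx) in xm.
have below_m' y : below n g m' y = false.
  apply: contraTF isT => my.
  have /mg ym : adj m' y by rewrite (below_adj n0 rg) ?inE.
  by rewrite (below_asym n0 ym) in my.
(* On the side of [G] the extra order is that of [f 0] with [m] moved to the front. Nothing lies
   below [m], so no comparability is lost; [lastr] is the dual statement for [m'] moved to the
   back. *)
have lastl x y : x != y -> below n f x y && (last (inl x) < last (inl y)) = below n f x y.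
  move=> nxy; apply: andb_idr => xy; rewrite /last.
  have ltxy := belowP _ _ _ _ xy 0 n0.
  case: (x =P m) nxy xy => [->|_] nxy xy; first by rewrite eq_sym (negPf nxy); lia.
  by case: (y =P m) xy => [->|_ _]; [rewrite below_m|lia].
have lastr x y : x != y -> below n g x y && (last (inr x) < last (inr y)) = below n g x y.
  move=> nxy; apply: andb_idr => xy; rewrite /last.
  have ltxy := belowP _ _ _ _ xy 0 n0; have := gN' 0 x n0.
  case: (x =P m') nxy xy => [->|_] nxy xy; first by rewrite below_m' in xy.
  by case: (y =P m') => _; lia.
have lastlr x y : (last (inl x) < last (inr y)) = (x == m) && (y == m').
  by rewrite /last; have := gN' 0 y n0; case: eqP; case: eqP => /=; lia.
exists h; split.
  move=> i; rewrite ltnS leq_eqVlt => /predU1P[->|ltin].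
    move=> z t _ _; rewrite /h eqxx.
    case: z t => [x|y] [x'|y'] /=.
    - case: eqP => [->|_]; case: eqP => [->|_] //; try lia.
      by move=> /addnI /(injf 0 n0) ->; rewrite ?inE.
    - by have := gN' 0 y' n0; case: eqP; case: eqP; lia.
    - by have := gN' 0 y n0; case: eqP; case: eqP; lia.
    - have := gN' 0 y n0; have := gN' 0 y' n0.
      case: eqP => [->|_]; case: eqP => [->|_] //; try lia.
      by move=> _ _ /(injg 0 n0) ->; rewrite ?inE.
  move=> [x|y] [x'|y'] _ _; rewrite /h ltn_eqF //.
  - by move/(injf i ltin) => ->; rewrite ?inE.
  - by have := fN i x ltin; lia.
  - by have := fN i x' ltin; lia.
  - by move/addnI/(injg i ltin) => ->; rewrite ?inE.
have hrl x y : below n h (inr y) (inl x) = false by rewrite below_asym.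
have bE : @adj (bridge_graph m m') =2 bridge_adj m m' by [].
move=> [x|y] [x'|y'] _ _ ne; rewrite bE !hS ?hl ?hr ?hlr ?hrl ?lastlr /= ?orbF //.
  have nx : x != x' by apply: contra ne => /eqP ->.
  by rewrite lastl // lastl 1?eq_sym // realf ?inE.
have ny : y != y' by apply: contra ne => /eqP ->.
by rewrite lastr // lastr 1?eq_sym // realg ?inE.
Qed.

(* Since [m'] is adjacent to no neighbour of [m] and [m] to no neighbour of
   [m'], an orientation of the bridge from [m] to [m'] forces all the edges at
   [m] to leave [m] and all the edges at [m'] to enter [m']. *)
Lemma bridge_source_sink :
  comparability_graph (bridge_graph m m') ->
  exists (q : rel G) (q' : rel G'),
    [/\ orientation q /\ transitive q, orientation q' /\ transitive q',
      forall x, adj m x -> q m x & forall y, adj m' y -> q' m' y].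
Proof.
case=> o0 [oo0 to0].
have [o [oo to omm]] : exists o : rel (bridge_graph m m'),
    [/\ orientation o, transitive o & o (inl m) (inr m')].
  have [|] := boolP (o0 (inl m) (inr m')); first by exists o0.
  have := proj2 oo0 (inl m) (inr m'); rewrite /= !eqxx => /(_ isT) or0 /negPf n0.
  exists (fun x y => o0 y x); split=> [|x y z xy yz|].
  - case: oo0 => adj0 orr; split=> x y; first by move/adj0; rewrite adj_sym.
    by rewrite addbC; apply: orr.
  - exact: to0 yz xy.
  - by move: or0; rewrite n0.
have [oadj oor] := oo.
(* The second orientation is reversed, which makes [m'] a source, so that [realizes_source] serves
   both sides. *)
exists (fun x y => o (inl x) (inl y)), (fun x y => o (inr y) (inr x)).
split.
- split=> [|x y z]; last exact: to.
  by split=> x y; [apply: (oadj (inl x) (inl y))|apply: (oor (inl x) (inl y))].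
- split=> [|x y z xy yz]; last exact: to yz xy.
  split=> x y; first by move/oadj; rewrite adj_sym.
  by rewrite addbC; apply: (oor (inr x) (inr y)).
- move=> x mx; have := oor (inl m) (inl x) mx.
  case: (o (inl m) (inl x)) => //= xm.
  have := oadj _ _ (to _ _ _ xm omm) => /= /andP[/eqP E _].
  by rewrite E adj_irr in mx.
- move=> y my; have := oor (inr m') (inr y) my.
  case: (boolP (o (inr y) (inr m'))) => //; rewrite addbF => _ my'.
  have := oadj _ _ (to _ _ _ omm my') => /= /andP[_ /eqP E].
  by rewrite E adj_irr in my.
Qed.

Lemma bridge_representable n :
  comparability_graph (bridge_graph m m') ->
  perm_representable G n -> perm_representable G' n ->
  perm_representable (bridge_graph m m') n.+1.
Proof.
move=> /bridge_source_sink[q [q' [[oq tq] [oq' tq'] qm qm']]].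
move=> /perm_representableP[n0 [f rf]] /perm_representableP[_ [g rg]].
have [||f1 [rf1 fm]] := realizes_source n0 rf oq tq (m := m); rewrite ?inE //.
  by move=> x _; apply: qm.
have [||g0 [rg0 gm]] := realizes_source n0 rg oq' tq' (m := m'); rewrite ?inE //.
  by move=> x _; apply: qm'.
(* Reversing the orders turns the source [m'] back into a sink. *)
have [g1 [rg1 g1E]] := realizes_rev rg0.
apply/perm_representableP; split=> //.
apply: (bridge_realizes n0 rf1 rg1) => x mx; first by rewrite fm ?inE.
by rewrite g1E gm ?inE.
Qed.

End Bridge.

(** * Comparison of the lower and upper bounds *)

Lemma perm_representable_leq (G : sgraph) k n :
  k <= n -> perm_representable G k -> perm_representable G n.
Proof.
move=> kn /perm_representableP[k0 [f rf]]; apply/perm_representableP.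
split; first exact: leq_trans kn.
by apply: (realizes_pad _ rf); rewrite k0.
Qed.

Theorem theorem5 (G G' : sgraph) (m : G) (m' : G') (k k' : nat)
  (connG : connected_graph G) (connG' : connected_graph G')
  (compG : comparability_graph G) (compG' : comparability_graph G')
  (Gk : perm_rep_number G k) (G'k' : perm_rep_number G' k')
  (compH : comparability_graph (bridge_graph m m')) :
  perm_rep_number (bridge_graph m m') (maxn k k') \/
  perm_rep_number (bridge_graph m m') (1 + maxn k k').
Proof.
have [[repG minG] [repG' minG']] := (Gk, G'k').
have lower j : perm_representable (bridge_graph m m') j -> maxn k k' <= j.
  move=> repH; rewrite geq_max; apply/andP; split.
    by apply: minG; apply: (@perm_representable_embed G (bridge_graph m m') inl) repH => // x y [].
  by apply: minG'; apply: (@perm_representable_embed G' (bridge_graph m m') inr) repH => // x y [].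
have upper : perm_representable (bridge_graph m m') (1 + maxn k k').
  apply: bridge_representable => //.
    exact: perm_representable_leq (leq_maxl _ _) repG.
  exact: perm_representable_leq (leq_maxr _ _) repG'.
(* The number lies between the maximum and its successor, so it only remains to ask whether the
   maximum suffices. *)
have [rep|nrep] := classic (perm_representable (bridge_graph m m') (maxn k k')).
  by left.
right; split=> // j repH; rewrite add1n ltn_neqAle lower // andbT.
by apply/eqP => E; rewrite E in nrep.
Qed.
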